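(* Let $f(x,y,z)$ be an invertible polynomial in three variables, of one of the Types I–V, and let $f^t$ be its Berglund–Hübsch transpose. Then $$A_{G_f}=\Gamma_{f^t},\qquad A_{G_{f^t}}=\Gamma_f$$ (as triples of numbers up to order). Namely, the Dolgachev numbers $A_{G_f}$ of the pair $(f,G_f)$ coincide with the Gabrielov numbers $\Gamma_{f^t}$ of $f^t$, and the Dolgachev numbers $A_{G_{f^t}}$ of the pair $(f^t,G_{f^t})$ coincide with the Gabrielov numbers $\Gamma_f$ of $f$.
   Context: Write $f=\sum_{i=1}^3\prod_{j=1}^3x_j^{E_{ij}}$ with $(x_1,x_2,x_3)=(x,y,z)$; the Berglund–Hübsch transpose is $f^t=\sum_{i=1}^3\prod_{j=1}^3x_j^{E_{ji}}$. The invertible polynomials in three variables are (up to weighted homogeneous coordinate change) the following, listed with their transposes: Type I: $f=x^{p_1}+y^{p_2}+z^{p_3}$, $f^t=x^{p_1}+y^{p_2}+z^{p_3}$ ($p_1,p_2,p_3\in\mathbb{Z}_{\ge2}$); Type II: $f=x^{p_1}+y^{p_2}+yz^{p_3/p_2}$, $f^t=x^{p_1}+y^{p_2}z+z^{p_3/p_2}$ ($p_1,p_2,\frac{p_3}{p_2}\in\mathbb{Z}_{\ge2}$); Type III: $f=x^{p_1}+zy^{q_2+1}+yz^{q_3+1}$, $f^t=x^{p_1}+zy^{q_2+1}+yz^{q_3+1}$ ($p_1\in\mathbb{Z}_{\ge2}$, $q_2,q_3\in\mathbb{Z}_{\ge1}$); Type IV: $f=x^{p_1}+xy^{p_2/p_1}+yz^{p_3/p_2}$,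 $f^t=x^{p_1}y+y^{p_2/p_1}z+z^{p_3/p_2}$ ($p_1,\frac{p_2}{p_1},\frac{p_3}{p_2}\in\mathbb{Z}_{\ge2}$); Type V: $f=x^{q_1}y+y^{q_2}z+z^{q_3}x$, $f^t=zx^{q_1}+xy^{q_2}+yz^{q_3}$ ($q_1,q_2,q_3\in\mathbb{Z}_{\ge1}$). After a permutation of the variables, $f^t$ is again a polynomial of the same type as $f$ (with different parameters), so the definitions below apply to $f^t$ as well. Dolgachev numbers. Let $G_f=\{(\lambda_1,\lambda_2,\lambda_3)\in(\mathbb{C}^* )^3:\prod_j\lambda_j^{E_{1j}}=\prod_j\lambda_j^{E_{2j}}=\prod_j\lambda_j^{E_{3j}}\}$. The Dolgachev numbers $A_{G_f}=(\alpha_1,\alpha_2,\alpha_3)$ of $(f,G_f)$ are the orders of the isotropy groups of the (at most three) isotropic points of the stack $\mathcal{C}_{G_f}=[(f^{-1}(0)\setminus\{0\})/G_f]$ (completed by $1$'s if there are fewer than three isotropic points). Explicitly: Type I: $(p_1,p_2,p_3)$; Type II: $(p_1,\frac{p_3}{p_2},(p_2-1)p_1)$; Type III: $(p_1,p_1q_2,p_1q_3)$; Type IV: $(\frac{p_3}{p_2},(p_1-1)\frac{p_3}{p_2},p_2-p_1+1)$; Type V: $(q_2q_3-q_3+1,q_3q_1-q_1+1,q_1q_2-q_2+1)$. Gabrielov numbers. The Gabrielov numbers $\Gamma_f=(\gamma_1,\gamma_2,\gamma_3)$ of $f$ are (they are the indices of the ''cusp singularity'' $x^{\gamma_1}+y^{\gamma_2}+z^{\gamma_3}+axyz$,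 $a\ne0$, associated to $f+xyz$): Type I: $(p_1,p_2,p_3)$; Type II: $(p_1,p_2,(\frac{p_3}{p_2}-1)p_1)$; Type III: $(p_1,p_1q_2,p_1q_3)$; Type IV: $(p_1,(\frac{p_3}{p_2}-1)p_1,\frac{p_3}{p_1}-\frac{p_3}{p_2}+1)$; Type V: $(q_2q_3-q_2+1,q_3q_1-q_3+1,q_1q_2-q_1+1)$. *)

(* Defs.v *)
From HB Require Import structures.
From mathcomp Require Import all_boot all_order all_algebra all_fingroup.
From mathcomp Require Import mpoly complex.
From mathcomp Require Import boolp classical_sets functions cardinality reals.

Set Implicit Arguments.
Unset Strict Implicit.
Unset Printing Implicit Defensive.

Import GRing.Theory.
Local Open Scope ring_scope.
Local Open Scope complex_scope.
Local Open Scope classical_set_scope.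
Local Open Scope card_scope.

(* A polynomial f = \sum_i \prod_j x_j^(E_ij) is represented by its exponent
   matrix E. *)
Definition expmx := 'M[nat]_3.

(* Berglund-Huebsch transpose: f^t = \sum_i \prod_j x_j^(E_ji). *)
Definition bh_transpose (E : expmx) : expmx := E^T.

Definition mx_of_rows (s : seq (seq nat)) : expmx :=
  \matrix_(i < 3, j < 3) nth 0%N (nth [::] s i) j.

(* The parameters are those of the usual presentation of the five types, in
   which the exponents may be quotients p3/p2, p2/p1; [inv_valid] makes all
   these quotients exact. *)
Inductive inv_type :=
  | TypeI (p1 p2 p3 : nat)
  | TypeII (p1 p2 p3 : nat)
  | TypeIII (p1 q2 q3 : nat)
  | TypeIV (p1 p2 p3 : nat)
  | TypeV (q1 q2 q3 : nat).

Definition inv_valid (t : inv_type) : bool :=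
  match t with
  | TypeI p1 p2 p3 => [&& 2 <= p1, 2 <= p2 & 2 <= p3]
  | TypeII p1 p2 p3 =>
      [&& 2 <= p1, 2 <= p2, p2 %| p3 & 2 <= p3 %/ p2]
  | TypeIII p1 q2 q3 => [&& 2 <= p1, 1 <= q2 & 1 <= q3]
  | TypeIV p1 p2 p3 =>
      [&& 2 <= p1, p1 %| p2, 2 <= p2 %/ p1, p2 %| p3 & 2 <= p3 %/ p2]
  | TypeV q1 q2 q3 => [&& 1 <= q1, 1 <= q2 & 1 <= q3]
  end%N.

Definition inv_expmx (t : inv_type) : expmx :=
  mx_of_rows
  match t with
  | TypeI p1 p2 p3 =>        (* x^p1 + y^p2 + z^p3 *)
      [:: [:: p1; 0; 0]; [:: 0; p2; 0]; [:: 0; 0; p3]]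
  | TypeII p1 p2 p3 =>       (* x^p1 + y^p2 + y z^(p3/p2) *)
      [:: [:: p1; 0; 0]; [:: 0; p2; 0]; [:: 0; 1; p3 %/ p2]]
  | TypeIII p1 q2 q3 =>      (* x^p1 + z y^(q2+1) + y z^(q3+1) *)
      [:: [:: p1; 0; 0]; [:: 0; q2 + 1; 1]; [:: 0; 1; q3 + 1]]
  | TypeIV p1 p2 p3 =>       (* x^p1 + x y^(p2/p1) + y z^(p3/p2) *)
      [:: [:: p1; 0; 0]; [:: 1; p2 %/ p1; 0]; [:: 0; 1; p3 %/ p2]]
  | TypeV q1 q2 q3 =>        (* x^q1 y + y^q2 z + z^q3 x *)
      [:: [:: q1; 1; 0]; [:: 0; q2; 1]; [:: 1; 0; q3]]
  end%N.

(* Under [inv_valid] none of the subtractions below is truncated. *)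
Definition gabrielov_triple (t : inv_type) : 3.-tuple nat :=
  match t with
  | TypeI p1 p2 p3 => [tuple p1; p2; p3]
  | TypeII p1 p2 p3 => [tuple p1; p2; (p3 %/ p2 - 1) * p1]
  | TypeIII p1 q2 q3 => [tuple p1; p1 * q2; p1 * q3]
  | TypeIV p1 p2 p3 =>
      [tuple p1; (p3 %/ p2 - 1) * p1; p3 %/ p1 - p3 %/ p2 + 1]
  | TypeV q1 q2 q3 =>
      [tuple q2 * q3 - q2 + 1; q3 * q1 - q3 + 1; q1 * q2 - q1 + 1]
  end%N.

(* s permutes the monomials, which leaves f unchanged, and u the variables. *)
Definition has_type (E : expmx) (t : inv_type) : Prop :=
  exists s u : 'S_3, forall i j, E i j = inv_expmx t (s i) (u j).

(* g lists, in some order, the Gabrielov numbers of the polynomial given by E,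
   read off after a permutation of the variables putting it in standard form. *)
Definition is_gabrielov (E : expmx) (g : 3.-tuple nat) : Prop :=
  exists t, [/\ inv_valid t, has_type E t & perm_eq g (gabrielov_triple t)].

Section Dolgachev.
Variables (R : realType) (E : expmx).
Local Notation C := R[i].

Definition inv_poly : {mpoly C[3]} := \sum_(i < 3) \prod_(j < 3) 'X_j ^+ E i j.

Definition symgroup : set 'rV[C]_3 :=
  [set l : 'rV[C]_3 | (forall j, l 0 j != 0) /\
    (forall i k, \prod_j l 0 j ^+ E i j = \prod_j l 0 j ^+ E k j)].

Definition torus_act (l v : 'rV[C]_3) : 'rV[C]_3 := \row_j (l 0 j * v 0 j).

Definition punctured_cone : set 'rV[C]_3 :=
  [set v : 'rV[C]_3 | inv_poly.@[fun j => v 0 j] = 0 /\ v != 0].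

Definition symorbit (v : 'rV[C]_3) : set 'rV[C]_3 :=
  [set torus_act l v | l in symgroup].

Definition isotropy (v : 'rV[C]_3) : set 'rV[C]_3 :=
  [set l : 'rV[C]_3 | symgroup l /\ torus_act l v = v].

(* v represents an isotropic point of the quotient stack of the punctured cone
   by [symgroup]: its isotropy group is not {(1, 1, 1)}. *)
Definition isotropic : set 'rV[C]_3 :=
  [set v : 'rV[C]_3 | punctured_cone v /\ isotropy v <> [set const_mx 1]].

(* a lists, in some order, the orders of the isotropy groups of the isotropic
   points (i.e. isotropic orbits) of the quotient stack, padded with 1's; the
   sizes of the two sequences force k <= 3. *)
Definition is_dolgachev (a : 3.-tuple nat) : Prop :=
  exists (k : nat) (pt : 'I_k -> 'rV[C]_3) (n : 'I_k -> nat),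
  [/\ forall i, isotropic (pt i) /\ isotropy (pt i) #= `I_(n i),
      forall i j, symorbit (pt i) = symorbit (pt j) -> i = j,
      forall v, isotropic v -> exists i, symorbit v = symorbit (pt i)
    & perm_eq a (codom n ++ nseq (3 - k) 1%N)].

End Dolgachev.

(* P and Q each hold of exactly the orderings of one triple, and it is the same
   triple for both: the unordered triples they describe are well defined and
   coincide. *)
Definition same_numbers (P Q : 3.-tuple nat -> Prop) : Prop :=
  exists a : 3.-tuple nat,
    (forall b, P b <-> perm_eq b a) /\ (forall b, Q b <-> perm_eq b a).

(* Main.v *)
Require Import Defs.
From mathcomp Require Import boolp classical_sets cardinality.
From mathcomp Require Import all_boot all_order all_algebra.
From mathcomp Require Import reals.
From mathcomp Require Import perm cyclotomic separable finmap mpoly complex.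
From mathcomp Require Import zify ring.

(** The isotropy group of a point v under the diagonal group G of E consists of
    the elements of G with coordinate 1 wherever v is nonzero, so it depends only
    on the support of v ([isotropyE]). It is trivial on full support, hence the
    isotropic points are found on the six proper nonempty supports: three edges
    (one coordinate zero) and three axes (two coordinates zero). On each of them:

    - if exactly one monomial survives, f cannot vanish there
      ([edge_empty], [axis_empty]);
    - on an edge where two monomials survive, f = 0 says that their ratio is -1.
      Hence this stratum of the cone is a single G-orbit, and its stabilizer is
      the group of n-th roots of unity, where n is the exponent of the missing
      variable in the third monomial ([edge_stratum]);
    - on an axis where no monomial survives, the stratum is a single orbit, and
      the equalities of the three monomials reduce to an equation t^N = 1 for one
      of the other coordinates, which determines the last one
      ([axis_stratum]).

    For the transpose of a polynomial of each of the five types exactly three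
    strata are nonempty, and their orders N are literally the entries of the
    Gabrielov triple of the type; strata with N = 1 account for the padding by
    ones ([dolgachev_faces], [dolgachev_transpose]).

    It remains to pass from the five normal forms to arbitrary presentations.
    Dolgachev numbers are unchanged under permutations of monomials and variables
    ([is_dolgachev_perm]). If E has type t, the Dolgachev numbers of its transpose
    are therefore the Gabrielov numbers computed from t; since the former do not
    mention t, two presentations of E yield the same Gabrielov numbers
    ([same_numbers_has_type]). The theorem is this statement for f and for f^t,
    the latter being again of one of the five types ([transpose_has_type]). *)

Set Implicit Arguments.
Unset Strict Implicit.
Unset Printing Implicit Defensive.

Import GRing.Theory Num.Theory.
Local Open Scope ring_scope.

(** * Roots of unity and three-element index sets *)

Lemma card_unity_roots (F : numClosedFieldType) (n : nat) :
  (0 < n)%N -> ([set z : F | z ^+ n = 1]%classic #= `I_n)%card.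
Proof.
move=> n_gt0.
have [rs defXn] := closed_field_poly_normal ('X^n - 1 : {poly F}).
rewrite (monicP _) ?monicXnsubC // scale1r in defXn.
have uniq_rs : uniq rs.
  rewrite -separable_prod_XsubC -defXn separable_Xn_sub_1 //.
  by rewrite pnatr_eq0 -lt0n.
have size_rs : size rs = n.
  by apply: succn_inj; rewrite -(size_XnsubC (1 : F) n_gt0) polyC1 defXn
    size_prod_XsubC.
have -> : [set z : F | z ^+ n = 1]%classic = [set` [fset z in rs]%fset]%classic.
  apply/seteqP; split=> z /=;
  rewrite inE -root_prod_XsubC -defXn rootE !hornerE;
  by [move=> ->; rewrite subrr | move/eqP/subr0_eq].
by apply/card_eq_fsetP; rewrite card_fseq undup_id.
Qed.

(** Stating everything for an arbitrary enumeration a, b, c of the indices lets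
    each argument below be made once for all rows and columns. *)
Section ThreeIndices.
Variables a b c : 'I_3.
Hypothesis uabc : uniq [:: a; b; c].

Let perm_abc : perm_eq (index_enum 'I_3) [:: a; b; c].
Proof.
rewrite perm_sym uniq_perm ?index_enum_uniq //.
have sub : {subset [:: a; b; c] <= index_enum 'I_3}.
  by move=> h _; rewrite mem_index_enum.
have [|_ eq_mem] := uniq_min_size uabc sub; last exact: eq_mem.
by rewrite -sum1_size sum1_card card_ord.
Qed.

Lemma mem_three h : h \in [:: a; b; c].
Proof. by rewrite -(perm_mem perm_abc) mem_index_enum. Qed.

Lemma forall_three (P : 'I_3 -> Prop) : P a -> P b -> P c -> forall h, P h.
Proof.
move=> Pa Pb Pc h; have := mem_three h.
by rewrite !inE => /or3P[] /eqP->.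
Qed.

Lemma sum_three (V : nmodType) (F : 'I_3 -> V) :
  \sum_h F h = F a + (F b + F c).
Proof. by rewrite (perm_big _ perm_abc) !big_cons big_nil Monoid.mulm1. Qed.

Lemma prod_three (A : comNzRingType) (F : 'I_3 -> A) :
  \prod_h F h = F a * (F b * F c).
Proof. by rewrite (perm_big _ perm_abc) !big_cons big_nil Monoid.mulm1. Qed.

Lemma row_three (T : Type) (x y z : T) :
  exists v : 'rV[T]_3, [/\ v ord0 a = x, v ord0 b = y & v ord0 c = z].
Proof.
exists (\row_h if h == a then x else if h == b then y else z).
move: uabc; rewrite /= !inE negb_or andbT => /andP[/andP[ab ac] bc].
by rewrite !mxE !eqxx eq_sym (negPf ab) eq_sym (negPf ac) eq_sym (negPf bc).
Qed.

End ThreeIndices.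

(** * Supports, stabilizers and orbits *)

Section Strata.
Variables (R : realType) (E : expmx).
Local Notation C := R[i].
Implicit Types (v w l : 'rV[C]_3) (S : {set 'I_3}) (a b c i j k h : 'I_3).

Definition monomial v a : C := \prod_h v 0 h ^+ E a h.

Definition vsupport v : {set 'I_3} := [set h | v 0 h != 0].

Definition stabilizer S : set 'rV[C]_3 :=
  [set l | symgroup E l /\ forall h, h \in S -> l 0 h = 1]%classic.

Lemma monomial_act l v a :
  monomial (torus_act l v) a = monomial l a * monomial v a.
Proof.
by rewrite /monomial -big_split; apply: eq_bigr => h _; rewrite mxE exprMn.
Qed.

Lemma monomial_eq0 v a h : h \notin vsupport v -> (0 < E a h)%N ->
  monomial v a = 0.
Proof.
rewrite inE negbK => /eqP vh0 Eah.
by rewrite /monomial (bigD1 h) //= vh0 expr0n gtn_eqF // mul0r.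
Qed.

Lemma punctured_coneE v :
  punctured_cone E v <-> \sum_a monomial v a = 0 /\ v != 0.
Proof.
rewrite /punctured_cone /= /inv_poly raddf_sum /=.
under eq_bigr => a _.
  rewrite rmorph_prod /=; under eq_bigr => h _ do rewrite rmorphXn /= mevalXU.
  over.
by [].
Qed.

Lemma support_act l v : symgroup E l -> vsupport (torus_act l v) = vsupport v.
Proof.
by case=> l0 _; apply/setP => h; rewrite !inE mxE mulf_eq0 (negPf (l0 h)).
Qed.

Lemma isotropyE v : isotropy E v = stabilizer (vsupport v).
Proof.
apply/seteqP; split=> l [Gl lv]; split=> //.
  move=> h; rewrite inE => vh; apply: (mulIf vh).
  by rewrite mul1r -[in RHS]lv mxE.
apply/rowP => h; rewrite mxE.
have [/lv ->|] := boolP (h \in vsupport v); first by rewrite mul1r.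
by rewrite inE negbK => /eqP->; rewrite mulr0.
Qed.

Lemma symgroup_three a b c l : uniq [:: a; b; c] -> (forall h, l 0 h != 0) ->
  monomial l a = monomial l b -> monomial l a = monomial l c -> symgroup E l.
Proof.
move=> uabc l0 ab ac; split=> // h k.
have E1 : forall h, monomial l h = monomial l a by apply: (forall_three uabc).
by rewrite -!/(monomial _ _) !E1.
Qed.

Lemma symgroup1 : symgroup E (const_mx 1 : 'rV[C]_3).
Proof.
split=> [h|h k]; first by rewrite mxE oner_eq0.
by rewrite !big1 // => j _; rewrite mxE expr1n.
Qed.

Lemma symgroup_mul l w :
  symgroup E l -> symgroup E w -> symgroup E (torus_act l w).
Proof.
move=> [l0 lE] [w0 wE]; split=> [h|h k]; first by rewrite mxE mulf_neq0.
by rewrite -!/(monomial _ _) !monomial_act /monomial (lE h k) (wE h k).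
Qed.

Definition torus_inv l : 'rV[C]_3 := map_mx GRing.inv l.

Lemma symgroup_inv l : symgroup E l -> symgroup E (torus_inv l).
Proof.
move=> [l0 lE]; split=> [h|h k]; first by rewrite mxE invr_eq0.
have invE a : \prod_j torus_inv l 0 j ^+ E a j = (\prod_j l 0 j ^+ E a j)^-1.
  by rewrite -prodfV; apply: eq_bigr => j _; rewrite mxE exprVn.
by rewrite !invE (lE h k).
Qed.

Lemma torus_actA l w v :
  torus_act l (torus_act w v) = torus_act (torus_act l w) v.
Proof. by apply/rowP => h; rewrite !mxE mulrA. Qed.

Lemma torus_actK l v : symgroup E l ->
  torus_act (torus_inv l) (torus_act l v) = v.
Proof. by case=> l0 _; apply/rowP => h; rewrite !mxE mulKf. Qed.

Lemma torus_act1 v : torus_act (const_mx 1) v = v.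
Proof. by apply/rowP => h; rewrite !mxE mul1r. Qed.

Lemma symorbit_act l v : symgroup E l ->
  symorbit E (torus_act l v) = symorbit E v.
Proof.
move=> Gl; apply/seteqP; split=> _ [w Gw <-].
  by rewrite torus_actA; exists (torus_act w l) => //; apply: symgroup_mul.
exists (torus_act w (torus_inv l)); last by rewrite -torus_actA torus_actK.
by apply: symgroup_mul => //; apply: symgroup_inv.
Qed.

Lemma symorbit_support v w :
  symorbit E v = symorbit E w -> vsupport v = vsupport w.
Proof.
move=> vw; have : symorbit E v v.
  by exists (const_mx 1); [exact: symgroup1 | rewrite torus_act1].
by rewrite vw => -[l Gl <-]; rewrite support_act.
Qed.

(** The stabilizers met below are cyclic; one coordinate m maps them bijectively
    onto the roots of unity, which gives their order. *)
Lemma stabilizer_card S m N : (0 < N)%N ->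
  (forall l, stabilizer S l -> l 0 m ^+ N = 1) ->
  (forall t, t ^+ N = 1 -> exists2 l, stabilizer S l & l 0 m = t) ->
  (forall l w, stabilizer S l -> stabilizer S w -> l 0 m = w 0 m -> l = w) ->
  (stabilizer S #= `I_N)%card.
Proof.
move=> N_gt0 Sroot rootS Sinj.
have proj_inj : {in stabilizer S &, injective (fun l : 'rV[C]_3 => l 0 m)}.
  by move=> l w; rewrite !in_setE; apply: Sinj.
apply: card_eq_trans (card_esym (inj_card_eq proj_inj)) _.
suff -> : ((fun l : 'rV[C]_3 => l 0 m) @` stabilizer S =
           [set z | z ^+ N = 1])%classic.
  exact: card_unity_roots.
apply/seteqP; split=> [_ [l Sl <-]|t /rootS[l Sl <-]] /=; first exact: Sroot.
by exists l.
Qed.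

(** The case N = 1, where the orbit is not an isotropic point, is included: the
    strata can then be described uniformly in the exponents. *)
Definition isotropic_stratum S N : Prop :=
  [/\ exists2 v, punctured_cone E v & vsupport v = S,
      forall v w, punctured_cone E v -> punctured_cone E w ->
        vsupport v = S -> vsupport w = S ->
        exists2 l, symgroup E l & torus_act l v = w
    & (stabilizer S #= `I_N)%card].

End Strata.

(** * The strata over the edges and the axes *)

Section EdgesAndAxes.
Variables (R : realType) (E : expmx) (a b c i j k : 'I_3).
Local Notation C := R[i].
Implicit Types (v w l : 'rV[C]_3) (h : 'I_3).
Hypotheses (uabc : uniq [:: a; b; c]) (uijk : uniq [:: i; j; k]).

Lemma punctured_cone_three v :
  punctured_cone E v <->
  monomial E v a + (monomial E v b + monomial E v c) = 0 /\ v != 0.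
Proof. by rewrite punctured_coneE (sum_three uabc). Qed.

Lemma monomial_three v h :
  monomial E v h = v 0 i ^+ E h i * (v 0 j ^+ E h j * v 0 k ^+ E h k).
Proof. exact: (prod_three uijk). Qed.

Lemma support_edge v :
  v 0 i = 0 -> v 0 j != 0 -> v 0 k != 0 -> vsupport v = [set~ i].
Proof.
move: uijk; rewrite /= !inE negb_or andbT => /andP[/andP[ij ik] _] vi vj vk.
apply/setP; apply: (forall_three uijk); rewrite !inE.
- by rewrite vi !eqxx.
- by rewrite vj (eq_sym j) ij.
- by rewrite vk (eq_sym k) ik.
Qed.

Lemma edge_support v :
  vsupport v = [set~ i] -> [/\ v 0 i = 0, v 0 j != 0 & v 0 k != 0].
Proof.
move: uijk; rewrite /= !inE negb_or andbT => /andP[/andP[ij ik] _] /setP supp.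
have := (supp i, supp j, supp k).
rewrite !inE eqxx (eq_sym j) ij (eq_sym k) ik /=.
by case=> [[/negbFE/eqP-> ->] ->].
Qed.

Lemma support_axis v :
  v 0 i = 0 -> v 0 j != 0 -> v 0 k = 0 -> vsupport v = [set j].
Proof.
move: uijk; rewrite /= !inE negb_or andbT => /andP[/andP[ij ik] jk] vi vj vk.
apply/setP; apply: (forall_three uijk); rewrite !inE.
- by rewrite vi (negPf ij) eqxx.
- by rewrite vj eqxx.
- by rewrite vk (eq_sym k) (negPf jk) eqxx.
Qed.

Lemma axis_support v :
  vsupport v = [set j] -> [/\ v 0 i = 0, v 0 j != 0 & v 0 k = 0].
Proof.
move: uijk; rewrite /= !inE negb_or andbT => /andP[/andP[ij ik] jk] /setP supp.
have := (supp i, supp j, supp k).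
rewrite !inE eqxx (negPf ij) (eq_sym k) (negPf jk) /=.
by case=> [[/negbFE/eqP-> ->] /negbFE/eqP->].
Qed.

Lemma row3P l w : l 0 i = w 0 i -> l 0 j = w 0 j -> l 0 k = w 0 k -> l = w.
Proof. by move=> li lj lk; apply/rowP; apply: (forall_three uijk). Qed.

Lemma support_neq0 v h : v 0 h != 0 -> v != 0.
Proof. by apply: contraNneq => ->; rewrite mxE. Qed.

(** On the edge i = 0 only the monomials a and b survive, and f = 0 says that
    they are opposite. An l taking v to w has its coordinates j and k prescribed;
    these preserve the ratio of the monomials a and b, and coordinate i is a root
    chosen to make monomial c agree too. The last hypothesis provides
    a point: with coordinate j equal to 1 the equation is a power of coordinate k
    being -1. *)
Lemma edge_stratum N :
  E a i = 0%N -> E b i = 0%N -> E c i = N -> (0 < N)%N -> (E a k < E b k)%N ->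
  isotropic_stratum R E [set~ i] N.
Proof.
move=> Eai Ebi <- Eci Eabk.
have edge_eq v : vsupport v = [set~ i] -> punctured_cone E v ->
    monomial E v a + monomial E v b = 0.
  move=> supp /punctured_cone_three[].
  by rewrite [monomial E v c](@monomial_eq0 _ _ _ _ i) ?addr0 // supp !inE eqxx.
split=> //.
- pose z : C := (E b k - E a k).-root (-1).
  have zE : z ^+ (E b k - E a k) = -1 by rewrite rootCK // subn_gt0.
  have z0 : z != 0.
    apply/eqP => z0; move: zE; rewrite z0 expr0n subn_eq0 leqNgt Eabk /=.
    by move/eqP; rewrite eq_sym oppr_eq0 oner_eq0.
  have [v [vi vj vk]] := row_three uijk (0 : C) 1 z.
  have supp : vsupport v = [set~ i].
    by apply: support_edge; rewrite ?vj ?vk ?oner_eq0.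
  exists v => //; apply/punctured_cone_three; split; last first.
    by apply: (support_neq0 (h := j)); rewrite vj oner_eq0.
  rewrite [monomial E v c](@monomial_eq0 _ _ _ _ i) ?addr0 //; last first.
    by rewrite supp !inE eqxx.
  rewrite !monomial_three Eai Ebi vj vk !expr0 !expr1n !mul1r.
  by rewrite -[E b k](subnK (ltnW Eabk)) exprD zE mulN1r subrr.
- move=> v w Cv Cw sv sw.
  have [vi vj vk] := edge_support sv; have [wi wj wk] := edge_support sw.
  pose p := w 0 j / v 0 j; pose q := w 0 k / v 0 k.
  have p0 : p != 0 by rewrite mulf_neq0 ?invr_eq0.
  have q0 : q != 0 by rewrite mulf_neq0 ?invr_eq0.
  pose r := (E c i).-root (p ^+ E a j * q ^+ E a k / (p ^+ E c j * q ^+ E c k)).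
  have rE : r ^+ E c i = p ^+ E a j * q ^+ E a k / (p ^+ E c j * q ^+ E c k).
    by rewrite rootCK.
  have r0 : r != 0.
    rewrite rootC_eq0 //.
    by rewrite !mulf_neq0 ?invr_eq0 ?mulf_neq0 ?expf_neq0.
  have [l [li lj lk]] := row_three uijk r p q.
  have lvw : torus_act l v = w.
    by apply: row3P; rewrite !mxE ?li ?lj ?lk ?vi ?wi ?mulr0 // divfK.
  exists l => //; apply: (symgroup_three uabc).
  + by apply: (forall_three uijk); rewrite ?li ?lj ?lk.
  + have va0 : monomial E v a != 0.
      by rewrite monomial_three Eai expr0 mul1r mulf_neq0 ?expf_neq0.
    apply: (mulIf va0); move: (edge_eq w sw Cw) (edge_eq v sv Cv).
    rewrite -lvw !monomial_act => wE /eqP; rewrite addrC addr_eq0 => /eqP vE.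
    by apply/eqP; rewrite -subr_eq0 -wE vE mulrN.
  + rewrite !monomial_three Eai li lj lk expr0 mul1r rE divfK //.
    by rewrite mulf_neq0 ?expf_neq0.
- have stabE l : stabilizer E [set~ i] l -> l 0 j = 1 /\ l 0 k = 1.
    move: uijk; rewrite /= !inE negb_or andbT => /andP[/andP[ij ik] _] [_ l1].
    by split; apply: l1; rewrite !inE eq_sym.
  apply: (@stabilizer_card _ _ _ i) => // [l Sl|t tN|l w Sl Sw liw].
  + have [lj lk] := stabE l Sl; have [[_ lE] _] := Sl.
    have := lE c a; rewrite -!/(monomial E l _) !monomial_three Eai lj lk.
    by rewrite !expr1n expr0 !mulr1.
  + have t0 : t != 0.
      apply: contraTneq (oner_neq0 C) => t0; rewrite -tN t0 expr0n.
      by rewrite gtn_eqF //= eqxx.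
    have [l [li lj lk]] := row_three uijk t 1 1; exists l => //; split.
      apply: (symgroup_three uabc).
      * by apply: (forall_three uijk); rewrite ?li ?lj ?lk ?oner_eq0.
      * by rewrite !monomial_three Eai Ebi lj lk !expr1n.
      * by rewrite !monomial_three Eai li lj lk tN !expr1n.
    by apply: (forall_three uijk); rewrite ?lj ?lk // !inE eqxx.
  + have [lj lk] := stabE l Sl; have [wj wk] := stabE w Sw.
    by apply: row3P; rewrite ?lj ?lk.
Qed.

(** With l j = 1 the monomial a is l i and the monomial c is l k ^ E c k, so
    membership in the group makes l i a power of l k, and monomial b turns into
    the exponent E b i * E c k + E b k of l k: the condition is l k ^ N = 1. For
    the five types every nonempty axis stratum has this shape in a suitable order
    of the rows and of the variables i and k. *)
Lemma axis_stratum N :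
  E a i = 1%N -> E a k = 0%N -> E c i = 0%N -> (0 < E c k)%N -> (0 < N)%N ->
  (N + E c k = E b i * E c k + E b k)%N ->
  isotropic_stratum R E [set j] N.
Proof.
move=> Eai Eak Eci Eck N0 NE.
have lN (l : 'rV[C]_3) : l 0 j = 1 -> l 0 k != 0 -> l 0 i = l 0 k ^+ E c k ->
    (monomial E l a = monomial E l b <-> l 0 k ^+ N = 1).
  move=> lj lk0 li; rewrite !monomial_three Eai Eak lj li.
  rewrite expr0 !expr1n !mul1r mulr1 expr1.
  rewrite -exprM -exprD mulnC -NE exprD; split=> [/eqP|->]; last by rewrite mul1r.
  by rewrite -{1}[_ ^+ _]mul1r => /eqP/mulIf-> //; rewrite expf_neq0.
split=> //.
- have [v [vi vj vk]] := row_three uijk (0 : C) 1 0.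
  have supp : vsupport v = [set j] by apply: support_axis; rewrite ?vj ?oner_eq0.
  have v0 : v != 0 by apply: (support_neq0 (h := j)); rewrite vj oner_eq0.
  exists v => //; apply/punctured_cone_three; split=> //.
  rewrite !monomial_three vi vj vk Eai !expr0n !expr1n /= mul0r add0r.
  rewrite (gtn_eqF Eck) !mulr0 addr0 mul1r.
  have : (0 < E b i * E c k + E b k)%N by rewrite -NE addn_gt0 N0.
  by case: (E b i) => [|e]; case: (E b k) => [|e'] //=; rewrite ?mul0r ?mulr0.
- move=> v w _ _ sv sw.
  have [vi vj vk] := axis_support sv; have [wi wj wk] := axis_support sw.
  pose p := w 0 j / v 0 j.
  have p0 : p != 0 by rewrite mulf_neq0 ?invr_eq0.
  pose A := p ^+ E a j; pose B := p ^+ E b j; pose D := p ^+ E c j.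
  have [A0 B0 D0] : [/\ A != 0, B != 0 & D != 0] by rewrite !expf_neq0.
  (* The three monomials of l must agree: A s = B s^m t^e = D t^n, where m, e and
     n are E b i, E b k and E c k. Eliminating s leaves this equation for t^N. *)
  pose t := N.-root (D / (B * (D / A) ^+ E b i)).
  have X0 : D / (B * (D / A) ^+ E b i) != 0.
    by rewrite !(mulf_neq0, invr_eq0, expf_neq0).
  have tN : t ^+ N = D / (B * (D / A) ^+ E b i) by rewrite rootCK.
  have t0 : t != 0 by rewrite rootC_eq0.
  pose s := D * t ^+ E c k / A.
  have s0 : s != 0 by rewrite !(mulf_neq0, invr_eq0, expf_neq0).
  have [l [li lj lk]] := row_three uijk s p t.
  exists l; last first.
    by apply: row3P; rewrite !mxE ?li ?lj ?lk ?vi ?wi ?vk ?wk ?mulr0 // divfK.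
  apply: (symgroup_three uabc).
  + by apply: (forall_three uijk); rewrite ?li ?lj ?lk.
  + rewrite !monomial_three Eai Eak li lj lk expr0 mulr1 expr1 -/A -/B.
    have sb : s ^+ E b i = (D / A) ^+ E b i * t ^+ (E b i * E c k).
      by rewrite /s mulrAC exprMn -exprM (mulnC (E c k)).
    have -> : s ^+ E b i * (B * t ^+ E b k) =
        B * (D / A) ^+ E b i * t ^+ (E b i * E c k + E b k).
      by rewrite sb exprD; ring.
    rewrite -NE exprD tN [RHS]mulrA [_ * (D / _)]mulrC !divfK //.
    by rewrite mulf_neq0 // expf_neq0 // mulf_neq0 ?invr_eq0.
  + by rewrite !monomial_three Eai Eak Eci li lj lk !expr0 mul1r mulr1 expr1 divfK.
- have stabE l : stabilizer E [set j] l -> [/\ l 0 j = 1, l 0 k != 0,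
      l 0 i = l 0 k ^+ E c k & l 0 k ^+ N = 1].
    move=> [[l0 lE] l1]; have lj : l 0 j = 1 by apply: l1; rewrite !inE.
    have li : l 0 i = l 0 k ^+ E c k.
      have := lE a c; rewrite -!/(monomial E l _) !monomial_three Eai Eak Eci lj.
      by rewrite !expr1n !expr0 !mul1r mulr1.
    by split=> //; apply/(lN l lj _ li); [exact: l0 | exact: lE].
  apply: (@stabilizer_card _ _ _ k) => // [l /stabE[]//|t tN|l w Sl Sw lkw].
  + have t0 : t != 0.
      apply: contraTneq (oner_neq0 C) => t0; rewrite -tN t0 expr0n.
      by rewrite gtn_eqF //= eqxx.
    have [l [li lj lk]] := row_three uijk (t ^+ E c k) 1 t; exists l => //; split.
      apply: (symgroup_three uabc).
      * by apply: (forall_three uijk); rewrite ?li ?lj ?lk ?oner_eq0 ?expf_neq0.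
      * by apply/lN; rewrite ?lk ?li.
      * by rewrite !monomial_three Eai Eak Eci li lj lk !expr1n !expr0 !mul1r mulr1.
    by move=> h; rewrite inE => /eqP->.
  + have [lj _ li _] := stabE l Sl; have [wj _ wi _] := stabE w Sw.
    by apply: row3P; rewrite ?lj ?li ?lkw.
Qed.

(** Monomial a is the only one surviving on the edge. *)
Lemma edge_empty v : punctured_cone E v ->
  E a i = 0%N -> (0 < E b i)%N -> (0 < E c i)%N -> vsupport v <> [set~ i].
Proof.
move=> /punctured_cone_three[+ _] Eai Ebi Eci sv.
have [vi vj vk] := edge_support sv.
have si : i \notin vsupport v by rewrite sv !inE eqxx.
rewrite (monomial_eq0 si Ebi) (monomial_eq0 si Eci) !addr0; apply/eqP.
by rewrite monomial_three Eai mul1r mulf_neq0 ?expf_neq0.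
Qed.

(** Monomial a is a pure power of variable j, the only one surviving on the
    axis. *)
Lemma axis_empty v : punctured_cone E v ->
  E a i = 0%N -> E a k = 0%N ->
  (0 < E b i + E b k)%N -> (0 < E c i + E c k)%N -> vsupport v <> [set j].
Proof.
move=> /punctured_cone_three[+ _] Eai Eak Eb Ec sv.
have [vi vj vk] := axis_support sv; rewrite !monomial_three Eai Eak vi vk !expr0n.
move: Eb Ec; rewrite !lt0n !addn_eq0 !negb_and.
case: (E b i == 0%N) (E b k == 0%N) (E c i == 0%N) (E c k == 0%N)
  => [] [] [] [] //= _ _; rewrite ?(mul0r, mulr0, addr0, mul1r, mulr1);
  apply/eqP; exact: expf_neq0.
Qed.

End EdgesAndAxes.

(** * Counting isotropic orbits *)

(** The proper nonempty supports: (true, i) is the edge on which only coordinate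
    i vanishes, (false, j) the axis on which only coordinate j does not. *)
Definition face := (bool * 'I_3)%type.

Definition face_set (f : face) : {set 'I_3} :=
  if f.1 then [set~ f.2] else [set f.2].

Lemma face_set_inj : injective face_set.
Proof.
have card_edge (i : 'I_3) : #|[set~ i]| = 2%N by rewrite cardsC1 card_ord.
rewrite /face_set => -[[] i] [[] j] /= eq_ij.
- by rewrite (set1_inj (setC_inj eq_ij)).
- by have := card_edge i; rewrite eq_ij cards1.
- by have := card_edge j; rewrite -eq_ij cards1.
- by rewrite (set1_inj eq_ij).
Qed.

Lemma face_setP (S : {set 'I_3}) :
  S != set0 -> S != setT -> exists f, S = face_set f.
Proof.
move=> S0 ST.
have : (0 < #|S| < 3)%N.
  rewrite card_gt0 S0 ltnNge; apply: contra ST => S3.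
  by rewrite eqEcard subsetT cardsT card_ord.
have SC : (#|S| + #|~: S| = 3)%N by rewrite cardsC card_ord.
case S1 : #|S| => [|[|[|]]] // _.
  by have/cards1P[i ->] : #|S| == 1%N by [rewrite S1]; exists (false, i).
have /cards1P[i Si] : #|~: S| == 1%N by rewrite -(eqn_add2l #|S|) SC S1.
by exists (true, i); rewrite /face_set /= -Si setCK.
Qed.

(** Padding by ones recovers a list of numbers from its entries different from 1;
    this is what makes strata with trivial isotropy harmless. *)
Lemma perm_pad_ones (s : seq nat) :
  perm_eq ([seq m <- s | m != 1%N] ++
           nseq (size s - size [seq m <- s | m != 1%N]) 1%N) s.
Proof.
rewrite perm_sym -(perm_filterC (fun m => m != 1%N) s) perm_cat2l.
have /all_pred1P-> : all (pred1 1%N) (filter (predC (fun m => m != 1%N)) s).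
  by rewrite all_filter; apply/allP => m _ /=; rewrite negbK; apply/implyP.
rewrite !size_filter -(count_predC (fun m => m != 1%N) s) addKn.
exact: perm_refl.
Qed.

Section Counting.
Variables (R : realType) (E : expmx).
Local Notation C := R[i].

Lemma vsupport_neq0 (v : 'rV[C]_3) : v != 0 -> vsupport v != set0.
Proof.
apply: contraNneq => v0; apply/eqP/rowP => j; rewrite mxE; apply/eqP.
by apply: negbNE; have := in_set0 j; rewrite -v0 inE => ->.
Qed.

Lemma stabilizer_setT :
  stabilizer E [set: 'I_3] = [set (const_mx 1 : 'rV[C]_3)]%classic.
Proof.
apply/seteqP; split=> [l [_ l1]|_ ->].
  by apply/rowP => h; rewrite mxE l1 ?inE.
by split=> [|h _]; [exact: symgroup1 | rewrite mxE].
Qed.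

(** A stabilizer contains the identity, so having order 1 means being trivial. *)
Lemma stabilizer_trivial S N : (stabilizer (R := R) E S #= `I_N)%card ->
  (stabilizer E S = [set (const_mx 1 : 'rV[C]_3)]%classic) <-> N = 1%N.
Proof.
have one : stabilizer E S (const_mx 1 : 'rV[C]_3).
  by split=> [|h _]; [exact: symgroup1 | rewrite mxE].
move=> SN; split=> [S1|N1].
  apply/card_eq_II; apply: card_eq_trans (card_esym SN) _; rewrite S1.
  exact: card_set1.
rewrite N1 in SN; have /eq_cardSP[l Sl] := SN.
rewrite II0 card_eq0 => /eqP S0.
have only_l w : stabilizer E S w -> w = l.
  move=> Sw; apply: contrapT => wl.
  by suff : (classical_sets.set0 : set 'rV[C]_3) w by []; rewrite -S0.
by apply/seteqP; split=> [w /only_l-> //=|_ -> //]; rewrite -(only_l _ one).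
Qed.

(** Each isotropic orbit is the stratum of exactly one of the three faces, and a
    face gives an isotropic orbit exactly when its order is not 1. Any enumeration
    of the isotropic orbits is thus, up to order, the list big of these faces. *)
Lemma dolgachev_faces (fs : 3.-tuple face) (ns : 3.-tuple nat) :
  uniq fs ->
  (forall i, isotropic_stratum R E (face_set (tnth fs i)) (tnth ns i)) ->
  (forall v, punctured_cone (R := R) E v ->
     forall f, f \notin fs -> vsupport v <> face_set f) ->
  forall b, is_dolgachev R E b <-> perm_eq b ns.
Proof.
move=> fs_uniq strata empties.
pose S i := face_set (tnth fs i); pose N := tnth ns.
have S_inj : injective S.
  by move=> i j /face_set_inj; apply/tuple_uniqP.
have /choice[pt0 pt0P] i : exists v : 'rV[C]_3,
    punctured_cone E v /\ vsupport v = S i.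
  by have [[v Cv Sv] _ _] := strata i; exists v.
have isoE i v : vsupport v = S i -> isotropy E v = stabilizer (R := R) E (S i).
  by move=> Sv; rewrite isotropyE Sv.
have isoN i v : vsupport (v : 'rV[C]_3) = S i ->
    (isotropy E v #= `I_(N i))%card.
  by move=> Sv; rewrite (isoE i) //; have [] := strata i.
have iso1 i v : punctured_cone E v -> vsupport (v : 'rV[C]_3) = S i ->
    isotropic E v <-> N i != 1%N.
  move=> Cv Sv; have [_ _ /stabilizer_trivial triv] := strata i.
  rewrite /isotropic /= (isoE i) //; split=> [[_ nt]|/eqP nt].
    by apply/eqP => /triv.
  by split=> // /triv.
have orbit i v w : punctured_cone E v -> punctured_cone E w ->
    vsupport v = S i -> vsupport w = S i ->
    symorbit E v = symorbit E w :> set 'rV[C]_3.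
  move=> Cv Cw Sv Sw; have [_ trans _] := strata i.
  by have [l Gl <-] := trans v w Cv Cw Sv Sw; rewrite symorbit_act.
have isotropic_face v : isotropic (R := R) E v -> exists i, vsupport v = S i.
  move=> [Cv nt]; have /punctured_coneE[_ v0] := Cv.
  have [|f Sv] := face_setP (vsupport_neq0 v0).
    by apply/eqP => vT; apply: nt; rewrite isotropyE vT stabilizer_setT.
  have [/tnthP[i fi]|/(empties v Cv)//] := boolP (f \in fs).
  by exists i; rewrite Sv fi.
pose big := [seq i <- enum 'I_3 | N i != 1%N].
have bigP : perm_eq ([seq N i | i <- big] ++ nseq (3 - size big) 1%N) ns.
  have nsE : [seq N i | i <- enum 'I_3] = ns by apply: map_tnth_enum.
  have := perm_pad_ones ns; rewrite size_tuple.
  have -> : [seq m <- ns | m != 1%N] = [seq N i | i <- big].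
    by rewrite -nsE filter_map.
  by rewrite size_map.
move=> b; split.
- move=> [k [pt [n [ptP pt_inj pt_onto /perm_trans]]]]; apply.
  have /choice[sg sgP] i : exists j, vsupport (pt i) = S j.
    by apply: isotropic_face; case: (ptP i).
  have ptC i : punctured_cone E (pt i) by case: (ptP i) => -[].
  have nE i : n i = N (sg i).
    apply/card_eq_II; case: (ptP i) => _ /card_esym/card_eq_trans; apply.
    exact: isoN.
  have sg_perm : perm_eq [seq sg i | i <- enum 'I_k] big.
    apply: uniq_perm.
    + rewrite map_inj_uniq ?enum_uniq // => i j sgij; apply: pt_inj.
      by apply: (orbit (sg i)); rewrite // sgij.
    + by rewrite filter_uniq ?enum_uniq.
    + move=> j; rewrite mem_filter mem_enum andbT; apply/mapP/idP => [[i _ ->]|Nj].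
        by apply/(iso1 _ _ (ptC i)) => //; case: (ptP i).
      have [Cj Sj] := pt0P j.
      have [i ji] := pt_onto (pt0 j) (iffRL (iso1 j _ Cj Sj) Nj).
      exists i; first by rewrite mem_enum.
      by apply: S_inj; rewrite -Sj -sgP; apply: symorbit_support ji.
  apply: perm_trans bigP; rewrite -(perm_size sg_perm) size_map size_enum_ord.
  rewrite perm_cat2r /codom /image_mem (eq_map nE) (map_comp N sg).
  exact: perm_map.
- move=> b_ns; pose k := size big.
  exists k, (fun i : 'I_k => pt0 (tnth (in_tuple big) i)),
    (fun i : 'I_k => N (tnth (in_tuple big) i)); split.
  + move=> i; have [Cj Sj] := pt0P (tnth (in_tuple big) i).
    split; last exact: isoN.
    apply/(iso1 _ _ Cj Sj); have := mem_tnth i (in_tuple big).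
    by rewrite mem_filter => /andP[].
  + move=> i j /symorbit_support.
    rewrite !(proj2 (pt0P _)) => /S_inj; apply/tuple_uniqP.
    by rewrite filter_uniq ?enum_uniq.
  + move=> v iv; have [j Sv] := isotropic_face v iv; have [Cv _] := iv.
    have Nj := iffLR (iso1 j v Cv Sv) iv; have [Cj Sj] := pt0P j.
    have /tnthP[i ji] : j \in in_tuple big by rewrite mem_filter Nj mem_enum.
    by exists i; rewrite -ji; apply: (orbit j).
  + apply: perm_trans b_ns _; rewrite perm_sym.
    apply: perm_trans bigP; rewrite perm_cat2r /codom /image_mem.
    by rewrite (map_comp N (tnth (in_tuple big))) map_tnth_enum.
Qed.

End Counting.

(** * Invariance under permutations of monomials and variables *)

Section Permutation.
Variables (R : realType) (E F : expmx) (s u : 'S_3).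
Hypothesis EF : forall i j, E i j = F (s i) (u j).
Local Notation C := R[i].
Implicit Types (v l : 'rV[C]_3).

Lemma monomial_perm v i : monomial E (col_perm u v) i = monomial F v (s i).
Proof.
rewrite /monomial [RHS](reindex_inj (@perm_inj _ u)).
by apply: eq_bigr => j _; rewrite mxE EF.
Qed.

Lemma symgroup_perm l : symgroup F l -> symgroup E (col_perm u l).
Proof.
move=> [l0 lF]; split=> [j|i k]; first by rewrite mxE.
by rewrite -!/(monomial _ _ _) !monomial_perm; apply: lF.
Qed.

Lemma punctured_cone_perm v :
  punctured_cone F v -> punctured_cone E (col_perm u v).
Proof.
move=> /punctured_coneE[sum0 v0]; apply/punctured_coneE; split.
  rewrite -[RHS]sum0 [RHS](reindex_inj (@perm_inj _ s)).
  by apply: eq_bigr => i _; apply: monomial_perm.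
apply: contraNneq v0 => uv0; apply/eqP/rowP => j.
by have /rowP/(_ (u^-1%g j)) := uv0; rewrite !mxE permKV.
Qed.

Lemma torus_act_perm l v :
  torus_act (col_perm u l) (col_perm u v) = col_perm u (torus_act l v).
Proof. by apply/rowP => j; rewrite !mxE. Qed.

End Permutation.

Lemma col_permK (T : Type) (u : 'S_3) :
  cancel (@col_perm T 1 3 u) (col_perm u^-1%g).
Proof. by move=> v; apply/rowP => j; rewrite !mxE permKV. Qed.

Lemma col_permVK (T : Type) (u : 'S_3) :
  cancel (@col_perm T 1 3 u^-1%g) (col_perm u).
Proof. by move=> v; apply/rowP => j; rewrite !mxE permK. Qed.

(** Permuting the coordinates transports cone, group and orbits of F to those of
    E; it is bijective, so isotropy orders and the enumeration of orbits follow. *)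
Lemma is_dolgachev_perm (R : realType) (E F : expmx) (s u : 'S_3) :
  (forall i j, E i j = F (s i) (u j)) ->
  forall b, is_dolgachev R F b -> is_dolgachev R E b.
Proof.
move=> EF; have FE i j : F i j = E (s^-1%g i) (u^-1%g j) by rewrite EF !permKV.
have symE (l : 'rV[R[i]]_3) : symgroup E (col_perm u l) <-> symgroup F l.
  split; last exact: symgroup_perm.
  by move/(symgroup_perm FE); rewrite col_permK.
have orbE (v : 'rV[R[i]]_3) :
    symorbit E (col_perm u v) = (col_perm u @` symorbit F v)%classic.
  apply/seteqP; split=> [_ [l Gl <-]|_ [_ [l Gl <-] <-]].
    rewrite -[l](col_permVK u) in Gl *; rewrite torus_act_perm.
    exists (torus_act (col_perm u^-1%g l) v) => //.
    by exists (col_perm u^-1%g l) => //; apply/symE.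
  by exists (col_perm u l); [apply/symE | rewrite torus_act_perm].
have isoE (v : 'rV[R[i]]_3) :
    isotropy E (col_perm u v) = (col_perm u @` isotropy F v)%classic.
  apply/seteqP; split=> [l [Gl lv]|_ [l [Gl lv] <-]].
    exists (col_perm u^-1%g l); last exact: col_permVK.
    rewrite -[l](col_permVK u) in Gl lv; split; first exact/symE.
    by apply: (can_inj (col_permK u)); rewrite -torus_act_perm.
  by split; [apply/symE | rewrite torus_act_perm lv].
have colperm1 w : col_perm w (const_mx 1) = const_mx 1 :> 'rV[R[i]]_3.
  by apply/rowP => j; rewrite !mxE.
have img_inj (A B : set 'rV[R[i]]_3) :
    (col_perm u @` A = col_perm u @` B)%classic -> A = B.
  move=> AB; have imgP (D : set 'rV[R[i]]_3) l :
      D l <-> (col_perm u @` D)%classic (col_perm u l).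
    by split=> [Dl|[w Dw /(can_inj (col_permK u)) <- //]]; exists l.
  by apply/seteqP; split=> l; rewrite (imgP A) (imgP B) AB.
have istE (v : 'rV[R[i]]_3) : isotropic E (col_perm u v) <-> isotropic F v.
  rewrite /isotropic /= isoE.
  have -> : (col_perm u @` isotropy F v = [set const_mx 1])%classic <->
      (isotropy F v = [set const_mx 1])%classic.
    split=> [img|->]; last by rewrite image_set1 colperm1.
    by apply: img_inj; rewrite img image_set1 colperm1.
  split=> -[Cv nt]; split=> //; last exact: punctured_cone_perm EF _ Cv.
  by rewrite -[v](col_permK u); apply: punctured_cone_perm FE _ Cv.
move=> b [k [pt [n [ptP pt_inj pt_onto bP]]]].
exists k, (fun i => col_perm u (pt i)), n; split=> //.
- move=> i; have [Ii ni] := ptP i; split; first exact/istE.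
  rewrite isoE; apply: card_eq_trans ni; apply: inj_card_eq.
  by move=> l w _ _; apply: (can_inj (col_permK u)).
- move=> i j; by rewrite !orbE => /img_inj/pt_inj.
- move=> v; rewrite -[v](col_permVK u) => /istE /pt_onto[i vi].
  by exists i; rewrite !orbE vi.
Qed.

(** * The five types *)

Local Notation x := (@Ordinal 3 0 isT).
Local Notation y := (@Ordinal 3 1 isT).
Local Notation z := (@Ordinal 3 2 isT).

Lemma bh_transposeE s i j :
  bh_transpose (mx_of_rows s) i j = nth 0%N (nth [::] s j) i.
Proof. by rewrite /bh_transpose /mx_of_rows !mxE. Qed.

Lemma notin_faces (fs : seq face) (P : face -> Prop) :
  (forall j, (true, j) \notin fs -> P (true, j)) ->
  (forall j, (false, j) \notin fs -> P (false, j)) ->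
  forall f, f \notin fs -> P f.
Proof. by move=> Pt Pf [[] j]; [apply: Pt | apply: Pf]. Qed.

Ltac exponents := rewrite ?bh_transposeE /=; nia.
(* The rows a, b, c and the variables i, j, k are the arguments of the lemma
   that each tactic applies; Cv is the proof that v lies on the cone. *)
Tactic Notation "edge" constr(a) constr(b) constr(c)
    constr(i) constr(j) constr(k) :=
  apply: (@edge_stratum _ _ a b c i j k); solve [done | exponents].
Tactic Notation "axis" constr(a) constr(b) constr(c)
    constr(i) constr(j) constr(k) :=
  apply: (@axis_stratum _ _ a b c i j k); solve [done | exponents].
Tactic Notation "no_edge" constr(Cv) constr(a) constr(b) constr(c)
    constr(i) constr(j) constr(k) :=
  apply: (@edge_empty _ _ a b c i j k isT isT _ Cv); exponents.
Tactic Notation "no_axis" constr(Cv) constr(a) constr(b) constr(c)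
    constr(i) constr(j) constr(k) :=
  apply: (@axis_empty _ _ a b c i j k isT isT _ Cv); exponents.

Lemma xyz_uniq : uniq [:: x; y; z]. Proof. by []. Qed.

(** The faces of each type are listed in the order of the entries of its Gabrielov
    triple. *)
Lemma dolgachev_transpose (R : realType) (t : inv_type) : inv_valid t ->
  forall b, is_dolgachev R (bh_transpose (inv_expmx t)) b <->
            perm_eq b (gabrielov_triple t).
Proof.
case: t => [p1 p2 p3|p1 p2 p3|p1 q2 q3|p1 p2 p3|q1 q2 q3] /=; rewrite /inv_expmx.
- move=> /and3P[p1_2 p2_2 p3_2].
  apply: (@dolgachev_faces _ _ [tuple (true, x); (true, y); (true, z)]) => //.
    apply: (forall_three xyz_uniq); rewrite /tnth /face_set /=.
    + edge y z x x y z.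
    + edge x z y y x z.
    + edge x y z z x y.
  move=> v Cv; apply: notin_faces; apply: (forall_three xyz_uniq) => //= _.
  + no_axis Cv x y z y x z.
  + no_axis Cv y x z x y z.
  + no_axis Cv z x y x z y.
- move: (p3 %/ p2)%N => r /and4P[p1_2 p2_2 _ r_2].
  apply: (@dolgachev_faces _ _ [tuple (true, x); (true, y); (false, y)]) => //.
    apply: (forall_three xyz_uniq); rewrite /tnth /face_set /=.
    + edge z y x x z y.
    + edge x z y y x z.
    + axis y z x z y x.
  move=> v Cv; apply: notin_faces; apply: (forall_three xyz_uniq) => //= _.
  + no_edge Cv x y z z x y.
  + no_axis Cv x y z y x z.
  + no_axis Cv z x y x z y.
- move=> /and3P[p1_2 q2_1 q3_1].
  apply: (@dolgachev_faces _ _ [tuple (true, x); (false, z); (false, y)]) => //.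
    apply: (forall_three xyz_uniq); rewrite /tnth /face_set /=.
    + edge z y x x z y.
    + axis z y x y z x.
    + axis y z x z y x.
  move=> v Cv; apply: notin_faces; apply: (forall_three xyz_uniq) => //= _.
  + no_edge Cv x y z y x z.
  + no_edge Cv x y z z x y.
  + no_axis Cv x y z y x z.
- move=> /and5P[p1_2 /dvdnP[a ->] a_2 /dvdnP[b ->] b_2].
  have p1_0 : (0 < p1)%N by lia.
  rewrite mulnK // in a_2 *; have ap1_0 : (0 < a * p1)%N by nia.
  rewrite (mulnK b) // in b_2 *; rewrite mulnA mulnK //.
  apply: (@dolgachev_faces _ _ [tuple (true, x); (false, y); (false, x)]) => //.
    apply: (forall_three xyz_uniq); rewrite /tnth /face_set /=.
    + edge z y x x z y.
    + axis y z x z y x.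
    + axis x y z y x z.
  move=> v Cv; apply: notin_faces; apply: (forall_three xyz_uniq) => //= _.
  + no_edge Cv z x y y x z.
  + no_edge Cv x y z z x y.
  + no_axis Cv z x y x z y.
- move=> /and3P[q1_1 q2_1 q3_1].
  apply: (@dolgachev_faces _ _ [tuple (false, x); (false, y); (false, z)]) => //.
    apply: (forall_three xyz_uniq); rewrite /tnth /face_set /=.
    + axis x z y z x y.
    + axis y x z x y z.
    + axis z y x y z x.
  move=> v Cv; apply: notin_faces; apply: (forall_three xyz_uniq) => //= _.
  + no_edge Cv z x y x y z.
  + no_edge Cv x y z y x z.
  + no_edge Cv y x z z x y.
Qed.

(** The transpose of a chain reverses it and the transpose of a loop changes its
    orientation; exchanging two variables restores the normal form. *)
Lemma transpose_has_type (t : inv_type) : inv_valid t ->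
  exists2 t', inv_valid t' & has_type (bh_transpose (inv_expmx t)) t'.
Proof.
have y_x : y != x by []. have z_x : z != x by [].
have x_y : x != y by []. have z_y : z != y by [].
case: t => [p1 p2 p3|p1 p2 p3|p1 q2 q3|p1 p2 p3|q1 q2 q3] /=.
- exists (TypeI p1 p2 p3) => //; exists 1%g, 1%g => i j; rewrite !perm1.
  rewrite bh_transposeE !mxE; move: i j.
  by apply: (forall_three xyz_uniq); apply: (forall_three xyz_uniq).
- move=> /and4P[p1_2 p2_2 /dvdnP[r ->]]; have p2_0 : (0 < p2)%N by lia.
  rewrite mulnK // => r_2; have r_0 : (0 < r)%N by lia.
  exists (TypeII p1 r (r * p2)).
    by rewrite /= p1_2 r_2 dvdn_mulr //= mulKn.
  exists (tperm y z), (tperm y z) => i j.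
  rewrite bh_transposeE !mxE mulnK // mulKn //.
  move: i j; apply: (forall_three xyz_uniq); apply: (forall_three xyz_uniq);
    by rewrite ?tpermL ?tpermR ?tpermD.
- exists (TypeIII p1 q2 q3) => //; exists 1%g, 1%g => i j; rewrite !perm1.
  rewrite bh_transposeE !mxE; move: i j.
  by apply: (forall_three xyz_uniq); apply: (forall_three xyz_uniq).
- move=> /and5P[p1_2 /dvdnP[a ->] a_2 /dvdnP[b ->] b_2].
  have p1_0 : (0 < p1)%N by lia.
  rewrite mulnK // in a_2 *; have ap1_0 : (0 < a * p1)%N by nia.
  rewrite (mulnK b) // in b_2 *; have b_0 : (0 < b)%N by lia.
  have ba_0 : (0 < b * a)%N by nia.
  exists (TypeIV b (b * a) (b * a * p1)).
    by rewrite /= b_2 dvdn_mulr // dvdn_mulr // !mulKn // a_2 p1_2.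
  exists (tperm x z), (tperm x z) => i j.
  rewrite bh_transposeE !mxE !mulKn // !mulnK //.
  move: i j; apply: (forall_three xyz_uniq); apply: (forall_three xyz_uniq);
    by rewrite ?tpermL ?tpermR ?tpermD.
- move=> /and3P[q1_1 q2_1 q3_1]; exists (TypeV q1 q3 q2).
    by rewrite /= q1_1 q3_1.
  exists (tperm y z), (tperm y z) => i j; rewrite bh_transposeE !mxE.
  move: i j; apply: (forall_three xyz_uniq); apply: (forall_three xyz_uniq);
    by rewrite ?tpermL ?tpermR ?tpermD.
Qed.

(** The type t is arbitrary, so applying the computation to two types of the same
    E shows that they have the same Gabrielov numbers. *)
Lemma same_numbers_has_type (R : realType) (E : expmx) (t : inv_type) :
  inv_valid t -> has_type E t ->
  same_numbers (is_dolgachev R (bh_transpose E)) (is_gabrielov E).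
Proof.
have dolgE t' : inv_valid t' -> has_type E t' ->
    forall b, is_dolgachev R (bh_transpose E) b <->
              perm_eq b (gabrielov_triple t').
  move=> t'_ok [s [u EF]] b; rewrite -(dolgachev_transpose R t'_ok).
  have EF' i j : bh_transpose E i j = bh_transpose (inv_expmx t') (u i) (s j).
    by rewrite /bh_transpose [LHS]mxE [RHS]mxE EF.
  have FE' i j : bh_transpose (inv_expmx t') i j =
      bh_transpose E (u^-1%g i) (s^-1%g j) by rewrite EF' !permKV.
  by split; apply: is_dolgachev_perm; [exact: FE' | exact: EF'].
move=> t_ok Et; exists (gabrielov_triple t); split; first exact: dolgE.
move=> b; split=> [[t' [t'_ok Et' bt']]|bt]; last by exists t.
by apply/(dolgE t) => //; apply/(dolgE t').
Qed.

Theorem theorem13 (R : realType) (t : inv_type) (ht : inv_valid t) :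
  let f := inv_expmx t in
  let ft := bh_transpose f in
  same_numbers (is_dolgachev R f) (is_gabrielov ft) /\
  same_numbers (is_dolgachev R ft) (is_gabrielov f).
Proof.
move=> f ft; split.
  have [t' t'_ok ft_t'] := transpose_has_type ht.
  by have := same_numbers_has_type R t'_ok ft_t'; rewrite /bh_transpose trmxK.
apply: (same_numbers_has_type R ht).
by exists 1%g, 1%g => i j; rewrite !perm1.
Qed.
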